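(* Let $\mathfrak{IV}$ be an integral vessel with $t_2$ ranging over $\mathbb R$, and let $I\Sigma$ be the associated system. Let $t_2^0\in\mathbb R$ be arbitrary. Then $I\Sigma$ is locally observable at $t_2^0$ if and only if $I\Sigma$ is observable at $t_2$ for all $t_2\in\mathbb R$.
   Context: Subscripts $*$ (as in $\sigma_{1*},\gamma_*,\mathcal E_*$) are part of the name and do not denote adjoints. ''Absolutely continuous'' and ''$L^1_{loc}$'' refer to the operator norm; absolutely continuous means on compact intervals. An (integral) vessel is a collection $$\mathfrak{IV}=(A_1(t_2),F(t_2,t_2^0),\widetilde B(t_2),C(t_2),D(t_2),\widetilde D(t_2);\sigma_1,\sigma_2,\gamma,\sigma_{1*},\sigma_{2*},\gamma_*;\mathcal H_{t_2},\mathcal E,\mathcal E_*,\widetilde{\mathcal E},\widetilde{\mathcal E}_* )$$ of Hilbert spaces and operator functions of $t_2$ with the following properties. (i) $F$ is an evolution semi-group: $F(t,s):\mathcal H_s\to\mathcal H_t$ is bounded and invertible, $F(r,s)F(s,t)=F(r,t)$, $F(t,t)=I$. (ii) $A_1(t_2):\mathcal H_{t_2}\to\mathcal H_{t_2}$, $\widetilde B(t_2):\widetilde{\mathcal E}\to\mathcal H_{t_2}$, $C(t_2):\mathcal H_{t_2}\to\mathcal E_*$ are bounded; for (almost) all $t$ the functions $s\mapsto F(t,s)\widetilde B(s)\sigma_1(s)$, $s\mapsto F(t,s)\widetilde B(s)\sigma_2(s)$, $s\mapsto C(s)F(s,t)$ are absolutely continuous. (iii) $D(t_2):\mathcal E\to\mathcal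 E_*$ and $\widetilde D(t_2):\widetilde{\mathcal E}\to\widetilde{\mathcal E}_*$ are absolutely continuous. (iv) $\sigma_2,\gamma\in L^1_{loc}$ with values in $\mathcal L(\mathcal E,\widetilde{\mathcal E})$; $\sigma_1(t_2)\in\mathcal L(\mathcal E,\widetilde{\mathcal E})$ is absolutely continuous with invertible values; likewise $\sigma_{2*},\gamma_*\in L^1_{loc}$ with values in $\mathcal L(\mathcal E_*,\widetilde{\mathcal E}_* )$ and $\sigma_{1*}(t_2)\in\mathcal L(\mathcal E_*,\widetilde{\mathcal E}_* )$ is absolutely continuous with invertible values. (v) The vessel conditions hold (those with derivatives for almost all $t_2$): $F(t_2,t_2^0)A_1(t_2^0)=A_1(t_2)F(t_2,t_2^0)$; $\frac{d}{dt_2}\big(F(t_2^0,t_2)\widetilde B\sigma_1\big)+F(t_2^0,t_2)A_1\widetilde B\sigma_2+F(t_2^0,t_2)\widetilde B\gamma=0$; $\sigma_{2*}CA_1F(t_2,t_2^0)-\sigma_{1*}\frac{d}{dt_2}[CF(t_2,t_2^0)]+\gamma_*CF(t_2,t_2^0)=0$; $\sigma_{1*}D=\widetilde D\sigma_1$, $\sigma_{2*}D=\widetilde D\sigma_2$, $\widetilde D\gamma=\sigma_{2*}C\widetilde B\sigma_1-\sigma_{1*}C\widetilde B\sigma_2-\sigma_{1*}\frac{dD}{dt_2}+\gamma_*D$. The associated system $I\Sigma$ is $\frac{\partial}{\partial t_1}x(t_1,t_2)=A_1(t_2)x(t_1,t_2)+\widetilde B(t_2)\sigma_1(t_2)u(t_1,t_2)$,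 $x(t_1,t_2)=F(t_2,t_2^0)x(t_1,t_2^0)+\int_{t_2^0}^{t_2}F(t_2,s)\widetilde B(s)\sigma_2(s)u(t_1,s)\,ds$, $y(t_1,t_2)=C(t_2)x(t_1,t_2)+D(t_2)u(t_1,t_2)$. The system is locally observable at $t_2$ if $$\mathcal O^\perp_{t_2}=\bigcap_{n\ge 0}\operatorname{Ker}C(t_2)A_1^n(t_2)=\{0\},$$ and observable at $t_2$ if $$\widetilde{\mathcal O}^\perp_{t_2}=\bigcap_{n\ge 0,\ s\in\mathbb R}\operatorname{Ker}C(s)A_1^n(s)F(s,t_2)=\{0\}.$$ *)

(* Defs.v *)
From HB Require Import structures.
From mathcomp Require Import all_boot all_order all_algebra.
From mathcomp Require Import all_classical all_reals all_analysis.
From mathcomp Require Import sesquilinear complex.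

Set Implicit Arguments.
Unset Strict Implicit.
Unset Printing Implicit Defensive.

Import Order.TTheory GRing.Theory Num.Theory.
Import numFieldNormedType.Exports.

Local Open Scope classical_set_scope.
Local Open Scope ring_scope.
Local Open Scope complex_scope.

(* Complex Hilbert spaces; the scalar product is linear in its first argument
   and antilinear in the second one. *)
HB.mixin Record CompleteNormedModule_isHilbert (R : realType) H
    & CompleteNormedModule R[i] H := {
  dotp : {dot H for (@Num.conj R[i])} ;
  normr_dotp : forall x : H, `|x| ^+ 2 = dotp x x }.

#[short(type="hilbertType")]
HB.structure Definition Hilbert (R : realType) :=
  {H of CompleteNormedModule R[i] H & CompleteNormedModule_isHilbert R H}.

(* The norm of a normed module over R[i] takes its (real) values in R[i]. *)
Definition rnorm (R : realType) (V : normedModType R[i]) (x : V) : R :=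
  complex.Re `|x|.

Section rnorm_lemmas.
Context (R : realType).

Lemma rnormE (V : normedModType R[i]) (x : V) : `|x| = (rnorm x)%:C.
Proof.
have := normr_ge0 x; rewrite /rnorm; case: `|x| => a b.
by rewrite lecE /= => /andP[/eqP -> _].
Qed.

Lemma rnorm_ge0 (V : normedModType R[i]) (x : V) : 0 <= rnorm x.
Proof. by have := normr_ge0 x; rewrite rnormE lecR. Qed.

Lemma rnorm0 (V : normedModType R[i]) : rnorm (0 : V) = 0.
Proof. by rewrite /rnorm normr0. Qed.

Lemma rnorm_eq0 (V : normedModType R[i]) (x : V) : rnorm x = 0 -> x = 0.
Proof. by move=> x0; apply/normr0_eq0; rewrite rnormE x0. Qed.

Lemma rnormD (V : normedModType R[i]) (x y : V) :
  rnorm (x + y) <= rnorm x + rnorm y.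
Proof. by rewrite -lecR rmorphD /= -!rnormE ler_normD. Qed.

Lemma rnormZ (V : normedModType R[i]) (a : R[i]) (x : V) :
  rnorm (a *: x) = complex.Re `|a| * rnorm x.
Proof.
apply: (@complexI R); rewrite rmorphM /= -!rnormE normrZ.
by congr (_ * _); rewrite (rnormE (a : R[i]^o)).
Qed.

End rnorm_lemmas.

Definition bounded_linear (R : realType) (E F : normedModType R[i]) :
    {pred E -> F} :=
  mem [set f : E -> F | linear f /\
    exists M : R, forall x, rnorm (f x) <= M * rnorm x].

Record bounded_op (R : realType) (E F : normedModType R[i]) := BoundedOp {
  bop_fun :> E -> F ;
  bop_funP : bop_fun \in @bounded_linear R E F }.

Section bounded_op.
Context (R : realType) (E F : normedModType R[i]).
Local Notation L := (@bounded_op R E F).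

HB.instance Definition _ := [isSub for @bop_fun R E F].
HB.instance Definition _ := [Choice of L by <:].

Lemma bopP (f g : L) : f = g <-> forall x, f x = g x.
Proof. by split=> [->//|fg]; exact/val_inj/funext. Qed.

Fact bounded_linear_submod : submod_closed (@bounded_linear R E F).
Proof.
split.
  rewrite inE; split=> [a x y|]; first by rewrite /= scaler0 addr0.
  by exists 0 => x; rewrite mul0r rnorm0.
move=> a f g; rewrite !inE => -[lf [M fM]] [lg [N gN]]; split=> [b x y|].
  rewrite !fctE lf lg !scalerDr !scalerA mulrC -!addrA; congr (_ + _).
  by rewrite addrCA.
exists (complex.Re `|a| * M + N) => x.
apply: (le_trans (rnormD _ _)); rewrite mulrDl lerD//.
rewrite fctE rnormZ -mulrA ler_wpM2l//; exact: (rnorm_ge0 (a : R[i]^o)).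
Qed.

HB.instance Definition _ :=
  GRing.isSubmodClosed.Build R[i] (E -> F) (@bounded_linear R E F)
    bounded_linear_submod.
HB.instance Definition _ := [SubChoice_isSubLmodule of L by <:].

Fact bop_linear (f : L) : linear f.
Proof. by have := bop_funP f; rewrite inE => -[]. Qed.

HB.instance Definition _ (f : L) :=
  GRing.isLinear.Build R[i] E F *:%R f (bop_linear f).

Definition opnorm (f : L) : R :=
  sup [set rnorm (f x) | x in [set x : E | rnorm x <= 1]].

Lemma opnorm_has_sup (f : L) :
  has_sup [set rnorm (f x) | x in [set x : E | rnorm x <= 1]].
Proof.
split; first by exists (rnorm (f 0)); exists 0; rewrite //= rnorm0.
have := bop_funP f; rewrite inE => -[_ [M fM]].
exists `|M| => _ [x /= x1 <-]; apply: (le_trans (fM x)).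
rewrite (le_trans (ler_norm _))// normrM ler_piMr//.
by rewrite ger0_norm ?rnorm_ge0.
Qed.

Lemma opnorm_ub (f : L) x : rnorm x <= 1 -> rnorm (f x) <= opnorm f.
Proof.
by move=> x1; apply: sup_ubound; [case: (opnorm_has_sup f)|exists x].
Qed.

Lemma opnorm_lub (f : L) (M : R) :
  (forall x, rnorm x <= 1 -> rnorm (f x) <= M) -> opnorm f <= M.
Proof.
move=> fM; apply: ge_sup; first by case: (opnorm_has_sup f).
by move=> _ [x /= x1 <-]; exact: fM.
Qed.

Lemma opnorm_ge0 (f : L) : 0 <= opnorm f.
Proof.
by apply: (le_trans (rnorm_ge0 (f 0))); apply: opnorm_ub; rewrite rnorm0.
Qed.

Lemma opnormP (f : L) x : rnorm (f x) <= opnorm f * rnorm x.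
Proof.
have [x0|x0] := eqVneq (rnorm x) 0.
  by rewrite (rnorm_eq0 x0) linear0 !rnorm0 mulr0.
have xgt0 : 0 < rnorm x by rewrite lt_def x0 rnorm_ge0.
have nV : complex.Re `|((rnorm x)^-1)%:C : R[i]| = (rnorm x)^-1.
  by rewrite ger0_norm ?lecR ?invr_ge0 ?rnorm_ge0.
rewrite -ler_pdivrMr// mulrC -nV -rnormZ -linearZ.
by apply: opnorm_ub; rewrite rnormZ nV mulVf.
Qed.

Fact opnormD (f g : L) : (opnorm (f + g))%:C <= (opnorm f)%:C + (opnorm g)%:C.
Proof.
rewrite -rmorphD lecR; apply: opnorm_lub => x x1.
by apply: (le_trans (rnormD _ _)); rewrite lerD ?opnorm_ub.
Qed.

Fact opnormZ (a : R[i]) (f : L) : (opnorm (a *: f))%:C = `|a| * (opnorm f)%:C.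
Proof.
rewrite (rnormE (a : R[i]^o)) -rmorphM /=; congr (_%:C).
have ge0a b : 0 <= rnorm (b : R[i]^o) by exact: rnorm_ge0.
have le_opZ (b : R[i]) (g : L) : opnorm (b *: g) <= rnorm (b : R[i]^o) * opnorm g.
  apply: opnorm_lub => x x1.
  by rewrite [X in rnorm X]/= rnormZ ler_wpM2l ?ge0a ?opnorm_ub.
apply/eqP; rewrite eq_le le_opZ /=.
have [->|a0] := eqVneq a 0.
  by rewrite (rnorm0 R[i]^o) mul0r opnorm_ge0.
have agt0 : 0 < rnorm (a : R[i]^o).
  rewrite lt_def ge0a andbT; apply: contra_neq a0; exact: (@rnorm_eq0 _ R[i]^o).
rewrite -ler_pdivlMl//.
rewrite -[in leLHS](scale1r f) -(mulVf a0) -scalerA.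
apply: (le_trans (le_opZ _ _)).
suff -> : rnorm (a^-1 : R[i]^o) = (rnorm (a : R[i]^o))^-1 by [].
apply: (@complexI R); rewrite fmorphV /= -!rnormE; exact: normfV.
Qed.

Fact opnorm_eq0 (f : L) : (opnorm f)%:C = 0 -> f = 0.
Proof.
move=> /(@complexI R) f0; apply/bopP => x; apply: rnorm_eq0.
by apply/eqP; rewrite eq_le rnorm_ge0 andbT (le_trans (opnormP f x))// f0 mul0r.
Qed.

HB.instance Definition _ :=
  Lmodule_isNormed.Build R[i] L opnormD opnormZ opnorm_eq0.

End bounded_op.

Notation "''L' ( E , F )" := (bounded_op E F)
  (at level 8, format "''L' ( E ,  F )") : type_scope.

Section bop_monoid.
Context (R : realType).

Fact idb_bounded (E : normedModType R[i]) : idfun \in @bounded_linear R E E.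
Proof. by rewrite inE; split=> //; exists 1 => x; rewrite mul1r. Qed.

Definition idb (E : normedModType R[i]) : 'L(E, E) := BoundedOp (idb_bounded E).

Fact compb_bounded (E F G : normedModType R[i]) (g : 'L(F, G)) (f : 'L(E, F)) :
  g \o f \in @bounded_linear R E G.
Proof.
rewrite inE; split=> [a x y|]; first by rewrite /= !linearP.
exists (opnorm g * opnorm f) => x; apply: (le_trans (opnormP _ _)).
by rewrite -mulrA ler_wpM2l ?opnorm_ge0 ?opnormP.
Qed.

Definition compb (E F G : normedModType R[i]) (g : 'L(F, G)) (f : 'L(E, F)) :
  'L(E, G) := BoundedOp (compb_bounded g f).

End bop_monoid.

Notation "g \ob f" := (compb g f)
  (at level 40, left associativity) : ring_scope.

Definition invertible (R : realType) (E F : normedModType R[i]) (f : 'L(E, F)) :=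
  exists g : 'L(F, E), g \ob f = idb E /\ f \ob g = idb F.

Section one_variable.
Context (R : realType) (V : normedModType R[i]).

Definition has_derivative (f : R -> V) (t : R) (df : V) :=
  (h^-1)%:C *: (f (t + h) - f t) @[h --> 0^'] --> df.

Definition absolutely_continuous_on (a b : R) (f : R -> V) :=
  forall e : R, 0 < e -> exists2 d : R, 0 < d &
    forall (n : nat) (u v : 'I_n -> R),
      (forall i, a <= u i /\ u i <= v i /\ v i <= b) ->
      trivIset setT (fun i => `]u i, v i[%classic) ->
      \sum_(i < n) (v i - u i) < d ->
      \sum_(i < n) rnorm (f (v i) - f (u i)) < e.

Definition absolutely_continuous (f : R -> V) :=
  forall a b, a <= b -> absolutely_continuous_on a b f.

Definition simple_function (g : R -> V) :=
  finite_set (range g) /\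
  forall y, measurable (g @^-1` [set y] : set (measurableTypeR R)).

Definition strongly_measurable (f : R -> V) :=
  exists g : nat -> R -> V, (forall n, simple_function (g n)) /\
    {ae (@lebesgue_measure R), forall t, g n t @[n --> \oo] --> f t}.

(* [locally_integrable] asks for Borel measurability, while the norm of a
   strongly measurable function is only Lebesgue measurable: hence the
   comparison almost everywhere with a Borel function. *)
Definition L1loc (f : R -> V) :=
  strongly_measurable f /\
  exists2 w : R -> R, locally_integrable setT w &
    {ae (@lebesgue_measure R), forall t, rnorm (f t) = w t}.

End one_variable.

(* In the names, a trailing [t] stands for a tilde and a trailing [s] for the
   subscript * (which is not an adjoint); [v_B] is the operator "B tilde".
   The derivatives are taken in the operator norm, and their existence at
   almost every point is part of the conditions where they occur. *)
Record integral_vessel (R : realType) := IntegralVessel {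
  v_H : R -> hilbertType R ;
  v_E : hilbertType R ;
  v_Es : hilbertType R ;
  v_Et : hilbertType R ;
  v_Ets : hilbertType R ;
  v_A1 : forall t, 'L(v_H t, v_H t) ;
  v_F : forall t s, 'L(v_H s, v_H t) ;
  v_B : forall t, 'L(v_Et, v_H t) ;
  v_C : forall t, 'L(v_H t, v_Es) ;
  v_D : R -> 'L(v_E, v_Es) ;
  v_Dt : R -> 'L(v_Et, v_Ets) ;
  v_sigma1 : R -> 'L(v_E, v_Et) ;
  v_sigma2 : R -> 'L(v_E, v_Et) ;
  v_gamma : R -> 'L(v_E, v_Et) ;
  v_sigma1s : R -> 'L(v_Es, v_Ets) ;
  v_sigma2s : R -> 'L(v_Es, v_Ets) ;
  v_gammas : R -> 'L(v_Es, v_Ets) ;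
  v_F_invertible : forall t s, invertible (v_F t s) ;
  v_F_comp : forall r s t, v_F r s \ob v_F s t = v_F r t ;
  v_F_id : forall t, v_F t t = idb (v_H t) ;
  v_B1_ac : {ae (@lebesgue_measure R), forall t,
    absolutely_continuous (fun s => v_F t s \ob v_B s \ob v_sigma1 s)} ;
  v_B2_ac : {ae (@lebesgue_measure R), forall t,
    absolutely_continuous (fun s => v_F t s \ob v_B s \ob v_sigma2 s)} ;
  v_C_ac : {ae (@lebesgue_measure R), forall t,
    absolutely_continuous (fun s => v_C s \ob v_F s t)} ;
  v_D_ac : absolutely_continuous v_D ;
  v_Dt_ac : absolutely_continuous v_Dt ;
  v_sigma1_ac : absolutely_continuous v_sigma1 ;
  v_sigma1_invertible : forall t, invertible (v_sigma1 t) ;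
  v_sigma2_L1loc : L1loc v_sigma2 ;
  v_gamma_L1loc : L1loc v_gamma ;
  v_sigma1s_ac : absolutely_continuous v_sigma1s ;
  v_sigma1s_invertible : forall t, invertible (v_sigma1s t) ;
  v_sigma2s_L1loc : L1loc v_sigma2s ;
  v_gammas_L1loc : L1loc v_gammas ;
  v_lax : forall t t0, v_F t t0 \ob v_A1 t0 = v_A1 t \ob v_F t t0 ;
  v_input : forall t0, {ae (@lebesgue_measure R), forall t,
    exists2 d, has_derivative (fun s => v_F t0 s \ob v_B s \ob v_sigma1 s) t d &
      d + v_F t0 t \ob v_A1 t \ob v_B t \ob v_sigma2 t
        + v_F t0 t \ob v_B t \ob v_gamma t = 0} ;
  v_output : forall t0, {ae (@lebesgue_measure R), forall t,
    exists2 d, has_derivative (fun s => v_C s \ob v_F s t0) t d &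
      v_sigma2s t \ob v_C t \ob v_A1 t \ob v_F t t0
        - v_sigma1s t \ob d
        + v_gammas t \ob v_C t \ob v_F t t0 = 0} ;
  v_link1 : forall t, v_sigma1s t \ob v_D t = v_Dt t \ob v_sigma1 t ;
  v_link2 : forall t, v_sigma2s t \ob v_D t = v_Dt t \ob v_sigma2 t ;
  v_link3 : {ae (@lebesgue_measure R), forall t,
    exists2 d, has_derivative v_D t d &
      v_Dt t \ob v_gamma t =
        v_sigma2s t \ob v_C t \ob v_B t \ob v_sigma1 t
          - v_sigma1s t \ob v_C t \ob v_B t \ob v_sigma2 t
          - v_sigma1s t \ob d
          + v_gammas t \ob v_D t}
}.

(* The coefficients of the overdetermined system
     d/dt1 x(t1, t2) = A1(t2) x(t1, t2) + B1(t2) u(t1, t2)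
     x(t1, t2) = F(t2, t20) x(t1, t20)
                 + \int_[t20, t2] F(t2, s) B2(s) u(t1, s) ds
     y(t1, t2) = C(t2) x(t1, t2) + D(t2) u(t1, t2) *)
Record integral_system (R : realType) := IntegralSystem {
  s_H : R -> hilbertType R ;
  s_U : hilbertType R ;
  s_Y : hilbertType R ;
  s_A1 : forall t, 'L(s_H t, s_H t) ;
  s_B1 : forall t, 'L(s_U, s_H t) ;
  s_F : forall t s, 'L(s_H s, s_H t) ;
  s_B2 : forall t, 'L(s_U, s_H t) ;
  s_C : forall t, 'L(s_H t, s_Y) ;
  s_D : R -> 'L(s_U, s_Y)
}.

Definition associated_system (R : realType) (IV : integral_vessel R) :
    integral_system R :=
  {| s_A1 := v_A1 IV ;
     s_B1 := fun t => v_B IV t \ob v_sigma1 IV t ;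
     s_F := v_F IV ;
     s_B2 := fun t => v_B IV t \ob v_sigma2 IV t ;
     s_C := v_C IV ;
     s_D := v_D IV |}.

Section system.
Context (R : realType) (S : integral_system R).

(* [J] is the integral of [f] from [a] to [b] (also when [b < a]), tested
   against all vectors; as [z] ranges over a complex space, the real parts
   of the scalar products determine [J]. *)
Definition is_integral (V : hilbertType R) (f : R -> V) (a b : R) (J : V) :=
  forall z : V,
    let g s := complex.Re (dotp (f s) z) in
    let I := `[Num.min a b, Num.max a b]%classic in
    (@lebesgue_measure R).-integrable I (EFin \o g) /\
    complex.Re (dotp J z) =
      (if a <= b then 1 else -1) * \int[@lebesgue_measure R]_(s in I) g s.

Definition trajectory (u : R -> R -> s_U S) (x : forall t1 t2, s_H S t2)
    (y : R -> R -> s_Y S) :=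
  [/\ forall t1 t2, has_derivative (x ^~ t2) t1
        (s_A1 S t2 (x t1 t2) + s_B1 S t2 (u t1 t2)),
      forall t1 t20 t2,
        is_integral (fun s => s_F S t2 s (s_B2 S s (u t1 s))) t20 t2
          (x t1 t2 - s_F S t2 t20 (x t1 t20)) &
      forall t1 t2, y t1 t2 = s_C S t2 (x t1 t2) + s_D S t2 (u t1 t2)].

Definition ker (V W : normedModType R[i]) (f : V -> W) : set V :=
  f @^-1` [set 0].

Definition local_unobservable_space (t2 : R) : set (s_H S t2) :=
  \bigcap_(n in [set: nat]) ker (s_C S t2 \o iter n (s_A1 S t2)).

Definition unobservable_space (t2 : R) : set (s_H S t2) :=
  \bigcap_(n in [set: nat]) \bigcap_(s in [set: R])
    ker (s_C S s \o iter n (s_A1 S s) \o s_F S s t2).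

Definition locally_observable (t2 : R) :=
  @local_unobservable_space t2 = [set 0].

Definition observable (t2 : R) := @unobservable_space t2 = [set 0].

End system.

(* Main.v *)
Require Import Defs.
From mathcomp Require Import all_boot all_order all_algebra.
From mathcomp Require Import all_classical all_reals all_analysis.
From mathcomp Require Import complex measurable_realfun lra.

(** Observability at every time follows from local observability at one time
    because the unobservable space lies in the local one up to the invertible
    evolution F.  For the converse, let x be locally unobservable at t0, write
    A for A1(t0), and consider the outputs g_n(t) = C(t) F(t, t0) A^n x.  They
    vanish at t0 for all n, and the output vessel condition, applied to A^n x
    with A1(t) F(t, t0) = F(t, t0) A, turns them into an infinite chain
      sigma_1* g_n' = sigma_2* g_(n+1) + gamma_* g_n   almost everywhere.
    Its solutions are determined by their values at t0 ([chain_uniqueness]), so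
    every g_n(t) is zero; as g_n(t) = C(t) A1(t)^n F(t, t0) x, the vector x is
    then unobservable.

    The infinite chain is a single linear differential equation in disguise:
    since |g_n| <= |A|^n Phi locally, with Phi independent of n, the shift
    n -> n+1 costs only a factor |A|, and the increments of g_n are bounded by
      |A|^n Phi c (int w),  where w = |A| |sigma_2*| + |gamma_*|
    and c locally bounds the inverse of sigma_1*.  On an interval where
    c (int w) is at most 1/2 the constant Phi can be halved again and again
    ([chain_local_uniqueness]), and an induction along the real line makes the
    conclusion global.

    The passage from the almost everywhere equation to increments is a mean
    value inequality for absolutely continuous functions with values in a normed
    space ([absolutely_continuous_mean_value]).  It is proved without integrating
    vector-valued functions: the exceptional null set is covered by an open set
    so small that absolute continuity makes the variation over it negligible,
    and all other points are handled through the derivative. *)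

Set Implicit Arguments.
Unset Strict Implicit.
Unset Printing Implicit Defensive.

Import Order.TTheory GRing.Theory Num.Theory.
Import numFieldNormedType.Exports.

Local Open Scope classical_set_scope.
Local Open Scope ring_scope.
Local Open Scope complex_scope.

(** * Induction along an interval *)

(** The least upper bound of the points reached from [a] is itself reached, and
    can be passed unless it is [b].  Letting one step straddle [s] (from any [u]
    on its left to any [v] on its right) covers both the limit step and the
    successor step. *)
Lemma real_induction (R : realType) (P : R -> Prop) (a b : R) :
  a <= b -> P a ->
  (forall s, a <= s <= b -> exists2 r : R, 0 < r &
     forall u v, a <= u -> u <= s -> s <= v -> v <= b -> s - r < u -> v < s + r ->
       P u -> P v) ->
  P b.
Proof.
move=> ab Pa step.
pose S := [set s | a <= s <= b /\ P s].
have Sa : S a by rewrite /S /= lexx ab.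
have ubS : ubound S b by move=> s [/andP[]].
have supS : has_sup S by split; [exists a|exists b].
have hubS : has_ubound S by exists b.
have leS x : S x -> x <= sup S by exact: (@ub_le_sup R S hubS x).
have as' : a <= sup S by exact: leS.
have sb : sup S <= b by apply: (ge_sup (ex_intro _ a Sa)).
have [|r r0 stepr] := step (sup S); first by rewrite as' sb.
have [u [/andP[au ub] Pu] us] := sup_adherent r0 supS.
have us' : u <= sup S by apply: leS; rewrite /S /= au ub.
have next v : sup S <= v -> v <= b -> v < sup S + r -> P v.
  by move=> sv vb vr; exact: (stepr u v).
have [bs|bs] := leP b (sup S); first by apply: next => //; lra.
pose v := Num.min b (sup S + r / 2).
have sv : sup S < v by rewrite lt_min bs /=; lra.
have vb : v <= b by rewrite ge_min lexx.
have vr : v < sup S + r by rewrite gt_min; apply/orP; right; lra.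
have : v <= sup S.
  apply: leS.
  by split; [rewrite vb andbT; lra|apply: next => //; exact: ltW].
by rewrite leNgt sv.
Qed.

(** * The mean value inequality for absolutely continuous functions *)

(** The intervals are enumerated by natural numbers in increasing order, which
    makes it easy to append one more interval on the right. *)
Lemma absolutely_continuous_sum (R : realType) (V : normedModType R[i])
    (f : R -> V) (a b e : R) :
  absolutely_continuous_on a b f -> 0 < e ->
  exists2 d : R, 0 < d & forall (n : nat) (u v : nat -> R),
    (forall i, (i < n)%N -> [/\ a <= u i, u i <= v i & v i <= b]) ->
    (forall i j, (i < j)%N -> (j < n)%N -> v i <= u j) ->
    \sum_(i < n) (v i - u i) < d ->
    \sum_(i < n) rnorm (f (v i) - f (u i)) < e.
Proof.
move=> ac e0; have [d d0 acd] := ac e e0; exists d => // n u v range order.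
apply: (acd n (fun i => u i) (fun i => v i)) => [i|].
  by have [] := range i (ltn_ord i).
move=> i j _ _ [x []] /=; rewrite !in_itv /= => /andP[uix xvi] /andP[ujx xvj].
apply/val_inj; case: (ltngtP i j) => // ij.
  by exfalso; move: (order _ _ ij (ltn_ord j)) => {ij} ?; lra.
by exfalso; move: (order _ _ ij (ltn_ord i)) => {ij} ?; lra.
Qed.

(** The function [m] is the measure of the part of the open cover to the left of
    a point; an interval inside the cover costs at least its length. *)
Lemma ae_open_gauge (R : realType) (P : R -> Prop) (d : R) :
  {ae (@lebesgue_measure R), forall t, P t} -> 0 < d ->
  exists (U : set R) (m : R -> R), [/\ open U, (forall t, ~ P t -> U t),
    (forall s, 0 <= m s < d), {homo m : u v / u <= v} &
    (forall u v, u <= v -> (forall x, u <= x <= v -> U x) ->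
       m u + (v - u) <= m v)].
Proof.
move=> [N [mN N0 PN]] d0.
have [|U [oU NU Ud]] := lebesgue_regularity_outer mN _ d0; first by rewrite [ltLHS]N0 ltry.
have mU : measurable U by exact: open_measurable.
have mu_mono (A B : set R) : measurable A -> measurable B -> A `<=` B ->
    (lebesgue_measure A <= lebesgue_measure B)%E.
  by move=> mA mB AB; apply: le_measure; rewrite ?inE.
have {}Ud : (lebesgue_measure U < d%:E)%E.
  rewrite [ltLHS](@measureDI _ _ _ (@lebesgue_measure R) U N mU mN).
  rewrite [X in (_ + X)%E](_ : _ = 0%E) ?adde0//.
  apply/eqP; rewrite -measure_le0 -[leRHS]N0; apply: mu_mono => //.
  exact: measurableI.
pose W s := U `&` `]-oo, s[%classic.
have mW s : measurable (W s) by exact: measurableI.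
have WU s : (lebesgue_measure (W s) <= lebesgue_measure U)%E.
  by apply: mu_mono => //; exact: subIsetl.
have Wfin s : lebesgue_measure (W s) \is a fin_num.
  by rewrite ge0_fin_numE// (le_lt_trans (WU s))// (lt_trans Ud)// ltry.
exists U, (fun s => fine (lebesgue_measure (W s))); split=> //.
- by move=> t Pt; apply: NU; exact: PN.
- move=> s; rewrite fine_ge0 ?measure_ge0//=.
  by rewrite -lte_fin fineK// (le_lt_trans (WU s)).
- move=> u v uv; rewrite fine_le//; apply: mu_mono => //.
  by apply: setIS; apply: subset_itvl; rewrite bnd_simp.
- move=> u v uv Uuv.
  rewrite -lee_fin EFinD !fineK//.
  have -> : (v - u)%:E = lebesgue_measure (`[u, v[%classic : set R).
    rewrite lebesgue_measure_itv /= lte_fin; case: ltgtP uv => // ->.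
    by rewrite subrr.
  have disj : W u `&` `[u, v[%classic = set0.
    apply/seteqP; split=> // x [[_]] /=; rewrite !in_itv /= => xu /andP[ux _].
    by move: (lt_le_trans xu ux); rewrite ltxx.
  have mI : measurable (`[u, v[%classic : set R) by exact: measurable_itv.
  rewrite -[leLHS](@measureU _ _ _ (@lebesgue_measure R) _ _ (mW u) mI disj).
  apply: mu_mono => //; first exact: measurableU.
  move=> x [[Ux]|] /=; rewrite /W /= !in_itv /=.
    by move=> xu; split=> //; exact: lt_le_trans uv.
  by move=> /andP[ux xv]; split=> //; apply: Uuv; rewrite ux ltW.
Qed.

(** Consequence, for small steps straddling [t], of the derivative of [f] at [t]
    having norm at most the derivative of [K]. *)
Definition growth_bounded_at (R : realType) (V : normedModType R[i])
    (f : R -> V) (K : R -> R) (t : R) :=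
  forall e : R, 0 < e -> exists2 r : R, 0 < r & forall u v,
    u <= t -> t <= v -> t - r < u -> v < t + r ->
    rnorm (f v - f u) <= K v - K u + e * (v - u).

(** Travel from [a] to [b] by steps straddling one point each.  At a good point
    the step obeys the wanted inequality up to an error [e] times its length.  At
    a bad point the step stays inside a small open cover of the bad points; such
    steps are recorded in a list of successive intervals, whose total length is
    below the threshold of absolute continuity for [e], so that together they
    contribute less than [e].  The monotonicity of [K] absorbs the recorded
    steps. *)
Lemma absolutely_continuous_mean_value (R : realType) (V : normedModType R[i])
    (f : R -> V) (K : R -> R) (a b : R) :
  a <= b -> absolutely_continuous_on a b f ->
  (forall u v, a <= u -> u <= v -> v <= b -> K u <= K v) ->
  {ae (@lebesgue_measure R), forall t, a <= t <= b -> growth_bounded_at f K t} ->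
  rnorm (f b - f a) <= K b - K a.
Proof.
move=> ab fac Kmono good.
suff main e : 0 < e -> rnorm (f b - f a) <= K b - K a + e * (b - a) + e.
  apply/ler_addgt0Pr => e e0.
  have c0 : 0 < b - a + 1 by lra.
  have /main : 0 < e / (b - a + 1) by rewrite divr_gt0.
  by rewrite -addrA -[X in _ * _ + X]mulr1 -mulrDr divfK// gt_eqF.
move=> e0.
have [d d0 small] := absolutely_continuous_sum fac e0.
have [U [m [oU badU m_bnd m_mono m_jump]]] := ae_open_gauge good d0.
(* [u i, v i] are the recorded steps made so far, inside the cover. *)
pose P s := exists (n : nat) (u v : nat -> R), [/\
  (forall i, (i < n)%N -> [/\ a <= u i, u i <= v i & v i <= s]),
  (forall i j, (i < j)%N -> (j < n)%N -> v i <= u j),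
  \sum_(i < n) (v i - u i) <= m s &
  rnorm (f s - f a) <= K s - K a + e * (s - a) +
    \sum_(i < n) rnorm (f (v i) - f (u i))].
have triangle s t : rnorm (f t - f a) <= rnorm (f s - f a) + rnorm (f t - f s).
  by rewrite -(subrKA (f s) (f t)) addrC; exact: rnormD.
suff [n [u [v [range order len bnd]]]] : P b.
  apply: (le_trans bnd); rewrite lerD2l ltW//; apply: small => //.
  by apply: (le_lt_trans len); have /andP[] := m_bnd b.
apply: (real_induction ab).
  exists 0, (fun=> a), (fun=> a); split=> //; rewrite !big_ord0.
    by have /andP[] := m_bnd a.
  by rewrite !subrr rnorm0 mulr0 !addr0.
move=> s sab; have [Us|Us] := pselect (U s).
- have /nbhs_ballP[r /= r0 rU] := open_nbhs_nbhs (conj oU Us).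
  exists r => // p q ap ps sq qb rp rq [n [u [v [range order len bnd]]]].
  have pq : p <= q by lra.
  (* A step inside the cover is appended to the list. *)
  exists n.+1, (fun i => if (i < n)%N then u i else p),
    (fun i => if (i < n)%N then v i else q); split.
  + move=> i _; case: ifP => // /range[aui uvi vip]; split=> //; lra.
  + move=> i j ij; rewrite ltnS => jn; rewrite (leq_trans ij jn).
    case: ifP => [|_]; first exact: order.
    by have [] := range i (leq_trans ij jn).
  + rewrite big_ord_recr /= ltnn.
    under eq_bigr do rewrite ltn_ord.
    apply: le_trans (m_jump p q pq _); first by rewrite lerD2r.
    move=> x /andP[px xq]; apply: rU; rewrite /ball /= ltr_norml; lra.
  + rewrite big_ord_recr /= ltnn.
    under eq_bigr do rewrite ltn_ord.
    have Kpq := Kmono p q ap pq qb.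
    have epq : e * (p - a) <= e * (q - a) by rewrite ler_pM2l// lerD2r.
    have := triangle p q; lra.
- have gs : growth_bounded_at f K s.
    by apply: contrapT => ngs; apply/Us/badU => /(_ sab).
  have [r r0 rs] := gs e e0.
  exists r => // p q ap ps sq qb rp rq [n [u [v [range order len bnd]]]].
  exists n, u, v; split=> //.
  + move=> i /range[aui uvi vip]; split=> //; lra.
  + by apply: (le_trans len); apply: m_mono; lra.
  + have := rs p q ps sq rp rq; have := triangle p q.
    have : e * (q - a) = e * (p - a) + e * (q - p) by rewrite -mulrDr; congr *%R; lra.
    lra.
Qed.

Section differentiation.
Context (R : realType).
Implicit Types (V W : normedModType R[i]).

Lemma rnormN V (x : V) : rnorm (- x) = rnorm x.
Proof. by rewrite /rnorm normrN. Qed.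

Lemma rnorm_realZ V (h : R) (x : V) : rnorm (h%:C *: x) = `|h| * rnorm x.
Proof.
rewrite rnormZ; congr (_ * _).
by rewrite normc_def /= expr0n addr0 sqrtr_sqr.
Qed.

(** Multiplied out, the difference quotient condition also makes sense at
    [s = t]. *)
Lemma has_derivative_approx V (f : R -> V) (t : R) (d : V) (e : R) :
  has_derivative f t d -> 0 < e ->
  exists2 r : R, 0 < r & forall s, `|s - t| < r ->
    rnorm (f s - f t - (s - t)%:C *: d) <= e * `|s - t|.
Proof.
move=> fd e0.
have e0' : (0 : R[i]) < e%:C by rewrite ltcR.
have /cvgrPdist_lt /(_ _ e0') := fd.
move=> [r /= r0 fr]; exists r => // s st.
have [->|ts] := eqVneq s t.
  by rewrite !subrr scale0r subrr rnorm0 normr0 mulr0.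
have st0 : s - t != 0 by rewrite subr_eq0.
have := fr (s - t); rewrite /ball_ /= sub0r normrN => /(_ st st0).
rewrite rnormE ltcR (addrC t) subrK => /ltW.
rewrite -rnormN opprB => le_e.
have -> : f s - f t - (s - t)%:C *: d =
    (s - t)%:C *: (((s - t)^-1)%:C *: (f s - f t) - d).
  by rewrite scalerBr scalerA -rmorphM /= mulfV// scale1r.
by rewrite rnorm_realZ mulrC ler_wpM2r.
Qed.

Lemma is_derive_approx (K : R -> R) (t k e : R) :
  is_derive t 1 K k -> 0 < e ->
  exists2 r : R, 0 < r & forall s, `|s - t| < r ->
    `|K s - K t - (s - t) * k| <= e * `|s - t|.
Proof.
move=> [dK Kk] e0.
have := dK; rewrite /derivable -[X in X -> _]/(cvg _) => /cvg_ex[l Kl].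
have lk : l = k by rewrite -Kk; apply/esym/cvg_lim.
move: Kl; rewrite lk => /cvgrPdist_lt /(_ _ e0)[r /= r0 fr].
exists r => // s st.
have [->|ts] := eqVneq s t.
  by rewrite !subrr mul0r subrr normr0 mulr0.
have st0 : s - t != 0 by rewrite subr_eq0.
have := fr (s - t); rewrite /ball_ /= sub0r normrN => /(_ st st0) /ltW.
rewrite /= -normrN opprB [_ *: 1]mulr1 subrK => le_e.
have -> : K s - K t - (s - t) * k =
    (s - t) * ((s - t)^-1 *: (K s - K t) - k).
  by rewrite mulrBr mulVKf.
by rewrite normrM mulrC ler_wpM2r.
Qed.

Lemma growth_bounded_at_derivative V (f : R -> V) (K : R -> R) (t k : R) (d : V) :
  has_derivative f t d -> is_derive t 1 K k -> rnorm d <= k ->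
  growth_bounded_at f K t.
Proof.
move=> fd Kk dk e e0.
have e2 : 0 < e / 2 by rewrite divr_gt0.
have [r1 r10 f1] := has_derivative_approx fd e2.
have [r2 r20 K2] := is_derive_approx Kk e2.
exists (Num.min r1 r2); first by rewrite lt_min r10.
move=> u v ut tv.
rewrite ltrBlDr -ltrBlDl -ltrBlDl !lt_min => /andP[u1 u2] /andP[v1 v2].
have Eu : `|u - t| = t - u by rewrite distrC ger0_norm// subr_ge0.
have Ev : `|v - t| = v - t by rewrite ger0_norm// subr_ge0.
have := f1 u; have := f1 v; have := K2 u; have := K2 v; rewrite Eu Ev.
move=> /(_ v2)/ler_normlP[Kv _] /(_ u2)/ler_normlP[_ Ku] /(_ v1) fv /(_ u1) fu.
have split_f : f v - f u = (f v - f t - (v - t)%:C *: d)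
    - (f u - f t - (u - t)%:C *: d) + (v - u)%:C *: d.
  have -> : (v - u)%:C *: d = (v - t)%:C *: d - (u - t)%:C *: d.
    by rewrite -scalerBl -rmorphB /= opprB subrKA.
  have -> : f v - f u = (f v - f t) - (f u - f t) by rewrite opprB subrKA.
  move: (f v - f t) (f u - f t) (_ *: d) (_ *: d) => p q a b.
  by rewrite (opprD q) [p - b + _]addrACA -opprD subrK.
have nd : rnorm ((v - u)%:C *: d) <= (v - u) * k.
  by rewrite rnorm_realZ ger0_norm ?subr_ge0 ?(le_trans ut)// ler_wpM2l// subr_ge0 (le_trans ut).
have : rnorm (f v - f u) <= e / 2 * (v - t) + e / 2 * (t - u) + (v - u) * k.
  rewrite split_f; apply: (le_trans (rnormD _ _)); apply: lerD nd.
  by apply: (le_trans (rnormD _ _)); rewrite rnormN; exact: lerD.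
lra.
Qed.

(** Lebesgue's differentiation theorem, for the integral from [s - 1]; only the
    behaviour near [s] matters for local uniqueness. *)
Lemma exists_primitive (w : R -> R) (s : R) :
  locally_integrable setT w -> (forall t, 0 <= w t) ->
  exists K : R -> R, [/\ {homo K : u v / u <= v},
    (forall e, 0 < e -> exists2 r : R, 0 < r &
      forall t, `|t - s| < r -> `|K t - K s| < e) &
    {ae (@lebesgue_measure R), forall t, s - 1 < t -> is_derive t 1 K (w t)}].
Proof.
move=> lw w0.
have iw y : (@lebesgue_measure R).-integrable `[s - 1, y] (EFin \o w).
  have [mw _ lwy] := lw; apply/integrableP; split.
    by apply/measurable_EFinP; exact: measurable_funTS.
  by apply: lwy => //; exact: segment_compact.
exists (fun t => \int[@lebesgue_measure R]_(x in `[s - 1, t]) w x); split.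
- move=> u v uv; rewrite /Rintegral fine_le ?integrable_fin_num//.
  apply: ge0_subset_integral => //=.
  + by have /integrableP[] := iw v.
  + by move=> x _; rewrite lee_fin.
  + by apply: subset_itvl; rewrite bnd_simp.
- move=> e e0.
  have ss : s - 1 < s + 1 by lra.
  have := parameterized_integral_continuous (ltW ss) (iw (s + 1)).
  have s_in : s \in `]s - 1, s + 1[ by rewrite in_itv /=; lra.
  move=> /(continuous_within_itvP _ ss)[/(_ s s_in) Kc _ _].
  have /cvgrPdist_lt /(_ _ e0)[r /= r0 Kr] := Kc.
  by exists r => // t ts; rewrite distrC; apply: Kr; rewrite /= distrC.
- have := FTC1 iw lw.
  apply: filterS; first exact: (ae_filter_ringOfSetsType (@lebesgue_measure R)).
  move=> t /= Kt st.
  have [|dK Kw] := Kt; first by rewrite lte_fin.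
  by split=> //; rewrite -derive1E.
Qed.

End differentiation.

(** * Absolutely continuous families of operators *)

Section operator_families.
Context (R : realType).
Implicit Types (V W : normedModType R[i]).

(** Absolute continuity applied to a single interval. *)
Lemma absolutely_continuous_at V (f : R -> V) (s e : R) :
  absolutely_continuous f -> 0 < e ->
  exists2 r : R, 0 < r & forall t, `|t - s| < r -> rnorm (f t - f s) < e.
Proof.
move=> fac e0; have [|d d0 small] := @absolutely_continuous_sum _ _ f (s - 1) (s + 1) e _ e0.
  by apply: fac; lra.
exists (Num.min d 1); first by rewrite lt_min d0 ltr01.
move=> t; rewrite lt_min => /andP[td t1].
have /ltr_normlP[t1l t1r] := t1.
have /ltr_normlP[tdl tdr] := td.
have [st|ts] := leP s t.
  have := small 1%N (fun=> s) (fun=> t); rewrite !big_ord1; apply.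
  - by move=> i _; split=> //; lra.
  - by move=> i j; case: j => // j; rewrite ltnS ltn0.
  - by lra.
rewrite -rnormN opprB.
have := small 1%N (fun=> t) (fun=> s); rewrite !big_ord1; apply.
- by move=> i _; split=> //; lra.
- by move=> i j; case: j => // j; rewrite ltnS ltn0.
- by lra.
Qed.

(** If [T] is the inverse of [S s] and [S t - S s] has norm at most
    [1 / (2 (|T| + 1))], then in the estimate
    [|y| <= |T| (|S t y| + |S t y - S s y|)] the last term is at most [|y| / 2] and
    can be absorbed by the left-hand side. *)
Lemma invertible_bounded_below V W (S : R -> 'L(V, W)) (s : R) :
  absolutely_continuous S -> invertible (S s) ->
  exists2 c : R, 0 < c & exists2 r : R, 0 < r & forall t, `|t - s| < r ->
    forall y, rnorm y <= c * rnorm (S t y).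
Proof.
move=> Sac [T [TS _]].
pose c := 2 * (opnorm T + 1).
have oT := opnorm_ge0 T.
have c0 : 0 < c by rewrite /c; lra.
have [|r r0 Sr] := absolutely_continuous_at s Sac (e := c^-1).
  by rewrite invr_gt0.
exists c => //; exists r => // t /Sr/ltW Sts y.
have {}Sts : rnorm (S t y - S s y) <= c^-1 * rnorm y.
  apply: le_trans (opnormP (S t - S s) y) _.
  by rewrite ler_wpM2r// rnorm_ge0.
have yE : y = T (S s y) by have /bopP/(_ y) := TS.
have : rnorm y <= (opnorm T + 1) * (rnorm (S t y) + c^-1 * rnorm y).
  rewrite {1}yE; apply: (le_trans (opnormP _ _)).
  apply: ler_pM; rewrite ?rnorm_ge0//; first lra.
  rewrite -[S s y](subrK (S t y)) addrC.
  by apply: (le_trans (rnormD _ _)); rewrite lerD2l -rnormN opprB.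
have -> : (opnorm T + 1) * (rnorm (S t y) + c^-1 * rnorm y) =
   c / 2 * rnorm (S t y) + rnorm y / 2.
  have -> : opnorm T + 1 = c / 2 by rewrite /c; lra.
  rewrite mulrDr; congr +%R.
  by rewrite mulrACA divff ?gt_eqF// mul1r mulrC.
lra.
Qed.

Lemma absolutely_continuous_lipschitz V W (f : R -> V) (g : R -> W) (k : R) :
  0 <= k -> (forall s t, rnorm (g t - g s) <= k * rnorm (f t - f s)) ->
  absolutely_continuous f -> absolutely_continuous g.
Proof.
move=> k0 gf fac a b ab e e0.
have k1 : 0 < k + 1 by lra.
have ek : 0 < e / (k + 1) by rewrite divr_gt0.
have [d d0 small] := fac a b ab _ ek; exists d => // n u v uv triv len.
have := small n u v uv triv len; rewrite ltr_pdivlMr//; apply: le_lt_trans.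
rewrite mulr_suml; apply: ler_sum => i _; apply: (le_trans (gf _ _)).
by rewrite mulrC ler_wpM2l ?rnorm_ge0// lerDl.
Qed.

Lemma absolutely_continuous_eval V W (G : R -> 'L(V, W)) (x : V) :
  absolutely_continuous G -> absolutely_continuous (fun t => G t x).
Proof.
apply: (absolutely_continuous_lipschitz (rnorm_ge0 x)) => s t.
by rewrite mulrC; exact: (opnormP (G t - G s) x).
Qed.

Lemma has_derivative_eval V W (G : R -> 'L(V, W)) (t : R) (d : 'L(V, W)) (x : V) :
  has_derivative G t d -> has_derivative (fun s => G s x) t (d x).
Proof.
move=> Gd; apply/cvgrPdist_lt => e.
rewrite ltcE => /andP[/eqP eim e0].
have -> : e = (complex.Re e)%:C by case: e eim e0 => ? ? /= ->.
have x1 : 0 < rnorm x + 1 by have := rnorm_ge0 x; lra.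
have ex : (0 : R[i]) < (complex.Re e / (rnorm x + 1))%:C.
  by rewrite ltcR divr_gt0.
have /cvgrPdist_lt /(_ _ ex) := Gd.
apply: filterS => h; rewrite !rnormE !ltcR ltr_pdivlMr//.
apply: le_lt_trans; apply: le_trans (opnormP (d - (h^-1)%:C *: (G (t + h) - G t)) x) _.
by rewrite ler_wpM2l ?opnorm_ge0// lerDl.
Qed.

Lemma iter_opnorm V (A : 'L(V, V)) (n : nat) (x : V) :
  rnorm (iter n A x) <= opnorm A ^+ n * rnorm x.
Proof.
elim: n => [|n IHn] /=; first by rewrite expr0 mul1r.
rewrite exprS -mulrA; apply: (le_trans (opnormP _ _)).
by rewrite ler_wpM2l// opnorm_ge0.
Qed.

End operator_families.

(** * Infinite chains of linear differential equations *)

Section integrability.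
Context (R : realType).

Lemma locally_integrable_abs (w : R -> R) :
  locally_integrable setT w -> locally_integrable setT (fun t => `|w t|).
Proof.
move=> [mw oT wK]; split=> //; first exact: measurableT_comp.
by move=> K KT cK; under eq_integral do rewrite normr_id; exact: wK.
Qed.

Lemma locally_integrable_scale (k : R) (w : R -> R) :
  locally_integrable setT w -> locally_integrable setT (fun t => k * w t).
Proof.
move=> [mw oT wK]; split=> //; first exact: measurable_funM.
move=> K KT cK; have /= mK := compact_measurable cK.
under eq_integral do rewrite normrM EFinM.
rewrite ge0_integralZl//=; first by rewrite lte_mul_pinfty ?lee_fin//; exact: wK.
apply/measurable_EFinP/measurableT_comp => //.
exact: measurable_funTS.
Qed.

Lemma geometric_bound_eq0 (x B : R) :
  0 <= x -> (forall j : nat, x <= B / 2 ^+ j) -> x = 0.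
Proof.
move=> x0 xB; apply/eqP; rewrite eq_le x0 andbT leNgt; apply/negP => xgt0.
have B0 : 0 <= B by have := xB 0%N; rewrite expr0 divr1; lra.
pose j := (Num.truncn (B / x)).+1.
have jB : B / x < j%:R by exact: truncnS_gt.
have : x * j%:R <= B.
  have := xB j; rewrite ler_pdivlMr ?exprn_gt0//; apply: le_trans.
  by rewrite ler_pM2l// -natrX ler_nat ltnW// ltn_expl.
by rewrite leNgt mulrC -ltr_pdivrMr// jB.
Qed.

End integrability.

Section Chain.
Context (R : realType) (V W : normedModType R[i]).
Context (S S2 G : R -> 'L(V, W)) (g : nat -> R -> V) (M : R).
Context (Sac : absolutely_continuous S) (Sinv : forall t, invertible (S t))
  (S2int : L1loc S2) (Gint : L1loc G) (M0 : 0 <= M)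
  (gac : forall n, absolutely_continuous (g n))
  (gode : {ae (@lebesgue_measure R), forall t, forall n,
    exists2 d, has_derivative (g n) t d &
      S t d = S2 t (g n.+1 t) + G t (g n t)})
  (gbnd : forall s, exists2 r : R, 0 < r & exists Phi : R,
    forall n t, `|t - s| < r -> rnorm (g n t) <= M ^+ n * Phi).

(** Solving the equation for the derivative of [g n] costs a local bound [c] of
    the inverse of [S]; replacing the norms of [S2] and [G] by the locally
    integrable functions that agree with them almost everywhere gives the weight
    [w]. *)
Lemma chain_growth :
  exists2 w : R -> R, locally_integrable setT w /\ (forall t, 0 <= w t) &
  forall s, exists2 c : R, 0 < c & exists2 r : R, 0 < r &
   {ae (@lebesgue_measure R), forall t, `|t - s| < r ->
     forall n B, rnorm (g n t) <= B -> rnorm (g n.+1 t) <= M * B ->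
     exists2 d, has_derivative (g n) t d & rnorm d <= c * B * w t}.
Proof.
have [_ [w2 lw2 S2w]] := S2int; have [_ [wG lwG Gw]] := Gint.
exists (fun t => M * `|w2 t| + `|wG t|).
  split=> [|t]; last by rewrite addr_ge0 ?mulr_ge0.
  apply: locally_integrableD; last exact: locally_integrable_abs.
  by apply: locally_integrable_scale; exact: locally_integrable_abs.
move=> s; have [c c0 [r r0 Sc]] := invertible_bounded_below Sac (Sinv s).
exists c => //; exists r => //.
have : \forall t \near almost_everywhere (@lebesgue_measure R),
  [/\ rnorm (S2 t) = w2 t, rnorm (G t) = wG t & forall n,
  exists2 d, has_derivative (g n) t d &
    S t d = S2 t (g n.+1 t) + G t (g n t)].
  have FF := ae_filter_ringOfSetsType (@lebesgue_measure R).
  by apply: filterS3 S2w Gw gode => t; split.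
apply: filterS; first exact: (ae_filter_ringOfSetsType (@lebesgue_measure R)).
move=> t [n2 nG ode] ts n B gB gMB; have [d gd Sd] := ode n.
exists d => //; apply: le_trans (Sc t ts d) _.
rewrite -mulrA ler_pM2l// Sd; apply: le_trans (rnormD _ _) _.
rewrite mulrDr; apply: lerD.
  apply: (le_trans (opnormP _ _)).
  rewrite mulrA mulrC (mulrC B) -n2 ger0_norm ?rnorm_ge0//.
  by rewrite ler_wpM2r// opnorm_ge0.
apply: (le_trans (opnormP _ _)).
rewrite mulrC -nG ger0_norm ?rnorm_ge0//.
by rewrite ler_wpM2r// opnorm_ge0.
Qed.

(** On a neighbourhood of [s] where [K] varies by at most [1 / (2 c)], a bound
    [|g n t| <= M ^+ n * Phi'] valid for all [n] and [t] gives, by the mean value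
    inequality from a common zero [u], the same bound with [Phi' / 2].  Starting
    from the local bound of the hypotheses and iterating leaves only zero. *)
Lemma chain_local_uniqueness (s : R) :
  exists2 r : R, 0 < r & forall u v, `|u - s| < r -> `|v - s| < r ->
    (forall n, g n u = 0) -> forall n, g n v = 0.
Proof.
have [w [lw w0] growth] := chain_growth.
have [c c0 [r1 r10 gr]] := growth s.
have [K [Kmono Kcont Kw]] := exists_primitive s lw w0.
have [r2 r20 gb] := gbnd s; have [Phi gPhi] := gb.
(* Two points within this bound of [K s] differ by at most [1 / (2 c)]. *)
have [|r3 r30 K3] := Kcont (4 * c)^-1; first by rewrite invr_gt0 mulr_gt0.
pose r := Num.min (Num.min r1 1) (Num.min r2 r3).
have nearE t : `|t - s| < r ->
    [/\ `|t - s| < r1, `|t - s| < 1, `|t - s| < r2 & `|t - s| < r3].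
  by rewrite !lt_min => /andP[/andP[-> ->] /andP[-> ->]].
have incr n B a b : 0 <= B ->
    (forall t, `|t - s| < r ->
       rnorm (g n t) <= B /\ rnorm (g n.+1 t) <= M * B) ->
    `|a - s| < r -> `|b - s| < r -> a <= b ->
    rnorm (g n b - g n a) <= c * B * (K b - K a).
  move=> B0 gB ra rb ab; rewrite mulrBr.
  apply: (@absolutely_continuous_mean_value _ _ _ (fun t => c * B * K t)) => //.
  - exact: gac.
  - by move=> p q _ pq _; rewrite ler_wpM2l ?mulr_ge0 ?(ltW c0)// Kmono.
  have FF := ae_filter_ringOfSetsType (@lebesgue_measure R).
  apply: filterS2 gr Kw => t tgr tK /andP[at' tb].
  have rt : `|t - s| < r.
    move: ra rb => /ltr_normlP[ra1 ra2] /ltr_normlP[rb1 rb2].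
    by apply/ltr_normlP; split; lra.
  have [t1 t11 _ _] := nearE t rt.
  have [gnB gSnB] := gB t rt.
  have [d gd dB] := tgr t1 n B gnB gSnB.
  apply: (growth_bounded_at_derivative gd _ dB).
  have Kt : is_derive t 1 K (w t).
    by apply: tK; move: t11 => /ltr_normlP[]; lra.
  exact: (is_deriveZ (c * B) Kt).
exists r; first by rewrite !lt_min r10 r20 r30 ltr01.
move=> u v ru rv gu.
have halving j n t : `|t - s| < r -> rnorm (g n t) <= M ^+ n * Phi / 2 ^+ j.
  elim: j n t => [|j IHj] n t rt.
    by rewrite expr0 divr1; apply: gPhi; have [] := nearE t rt.
  set B := M ^+ n * Phi / 2 ^+ j.
  have B0 : 0 <= B by apply: le_trans (rnorm_ge0 (g n t)) (IHj n t rt).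
  have gB t' : `|t' - s| < r ->
      rnorm (g n t') <= B /\ rnorm (g n.+1 t') <= M * B.
    by move=> rt'; split; rewrite ?IHj// /B !mulrA -exprS IHj.
  have Kc p : `|p - s| < r -> c * `|K p - K s| <= 1 / 4.
    move=> /nearE[_ _ _ /K3/ltW].
    by rewrite -(ler_pM2l c0) invfM mulrCA divff ?gt_eqF// mulr1 div1r.
  have -> : M ^+ n * Phi / 2 ^+ j.+1 = B / 2.
    by rewrite exprS invfM mulrCA mulrC.
  have Kc2 p q : `|p - s| < r -> `|q - s| < r -> c * B * (K q - K p) <= B / 2.
    move=> /Kc Kp /Kc Kq; rewrite mulrAC (mulrC _ B) ler_wpM2l//.
    have -> : K q - K p = (K q - K s) - (K p - K s) by rewrite opprB subrKA.
    rewrite mulrBr.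
    have : c * (K q - K s) <= c * `|K q - K s| by rewrite ler_pM2l// ler_norm.
    have : - (c * (K p - K s)) <= c * `|K p - K s|.
      by rewrite -mulrN ler_pM2l// -normrN ler_norm.
    lra.
  have [ut|/ltW tu] := leP u t.
    have := incr n B u t B0 gB ru rt ut; rewrite gu subr0 => /le_trans; apply.
    exact: Kc2.
  have := incr n B t u B0 gB rt ru tu; rewrite gu sub0r rnormN => /le_trans; apply.
  exact: Kc2.
move=> n; apply: rnorm_eq0.
by apply: (geometric_bound_eq0 (B := M ^+ n * Phi)) => [|j]; rewrite ?rnorm_ge0 ?halving.
Qed.

(** The bound [gbnd], geometric in [n], is essential: the successive derivatives
    of a flat smooth function form a chain that vanishes at a point but not around it.
    Real induction goes from left to right only; applying it to the equivalence
    of the vanishing at [x] and at [z] covers both directions. *)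
Lemma chain_uniqueness (a b : R) :
  (forall n, g n a = 0) -> forall n, g n b = 0.
Proof.
suff main x y : x <= y -> (forall n, g n x = 0) <-> (forall n, g n y = 0).
  by have [ab|/ltW ba] := leP a b; [have [] := main a b ab|have [] := main b a ba].
move=> xy.
apply: (@real_induction R
  (fun z => (forall n, g n x = 0) <-> (forall n, g n z = 0)) x y xy) => //.
move=> s _; have [r r0 loc] := chain_local_uniqueness s.
exists r => // u v _ us sv _ su vs [xu ux].
have ru : `|u - s| < r by apply/ltr_normlP; split; lra.
have rv : `|v - s| < r by apply/ltr_normlP; split; lra.
by split=> [/xu|/(loc v u rv ru)/ux//]; exact: loc.
Qed.

End Chain.

(** * Observability *)

Section Observability.
Context (R : realType) (IV : integral_vessel R).

Lemma F_iter_A1 (t s : R) (n : nat) (x : v_H IV s) :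
  v_F IV t s (iter n (v_A1 IV s) x) = iter n (v_A1 IV t) (v_F IV t s x).
Proof.
elim: n => //= n IHn; have /bopP/(_ (iter n (v_A1 IV s) x)) /= := v_lax IV t s.
by rewrite IHn.
Qed.

(** The absolute continuity is given for almost all base points; one such base
    point [t1] suffices, as [F(s, t0) = F(s, t1) F(t1, t0)]. *)
Lemma CF_absolutely_continuous (t0 : R) :
  absolutely_continuous (fun s => v_C IV s \ob v_F IV s t0).
Proof.
have mu0 : (0 < @lebesgue_measure R setT)%E.
  by rewrite -set_itvNyy lebesgue_measure_itv /= ltry.
have PF := ae_properfilter_algebraOfSetsType mu0.
have [t1 CF1] := @filter_ex _ _ PF _ (v_C_ac IV).
apply: (absolutely_continuous_lipschitz (opnorm_ge0 (v_F IV t1 t0)) _ CF1).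
move=> s t; apply: opnorm_lub => x x1.
have E p : v_C IV p (v_F IV p t0 x) = v_C IV p (v_F IV p t1 (v_F IV t1 t0 x)).
  by have /bopP/(_ x) /= -> := v_F_comp IV p t1 t0.
rewrite [X in rnorm X](_ : _ = (v_C IV t \ob v_F IV t t1 -
    v_C IV s \ob v_F IV s t1) (v_F IV t1 t0 x)); last first.
  exact: (congr2 (fun p q => p - q) (E t) (E s)).
apply: (le_trans (opnormP _ _)); rewrite mulrC.
by apply: ler_wpM2r; [exact: opnorm_ge0|exact: opnorm_ub].
Qed.

(** The outputs along the orbit of [x] under [v_A1 IV t0] solve a chain of
    differential equations with zero values at [t0]. *)
Lemma local_unobservable_transport (t0 s : R) (x : v_H IV t0) :
  (forall n, v_C IV t0 (iter n (v_A1 IV t0) x) = 0) ->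
  forall n, v_C IV s (iter n (v_A1 IV s) (v_F IV s t0 x)) = 0.
Proof.
move=> x0.
pose A := v_A1 IV t0.
pose G t := v_C IV t \ob v_F IV t t0.
pose g n t := G t (iter n A x).
have Gac : absolutely_continuous G := CF_absolutely_continuous t0.
suff : forall n, g n s = 0 by move=> gs n; rewrite -F_iter_A1; exact: gs.
apply: (@chain_uniqueness R (v_Es IV) (v_Ets IV) (v_sigma1s IV) (v_sigma2s IV)
  (v_gammas IV) g (opnorm A) _ _ _ _ _ _ _ _ t0) => //.
- exact: v_sigma1s_ac.
- exact: v_sigma1s_invertible.
- exact: v_sigma2s_L1loc.
- exact: v_gammas_L1loc.
- exact: opnorm_ge0.
- by move=> n; exact: absolutely_continuous_eval.
- have := v_output IV t0; apply: filterS.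
    exact: (ae_filter_ringOfSetsType (@lebesgue_measure R)).
  move=> t [d Gd dE] n; exists (d (iter n A x)).
    exact: has_derivative_eval.
  set y := iter n A x.
  have eqn : v_sigma2s IV t (v_C IV t (v_A1 IV t (v_F IV t t0 y)))
      - v_sigma1s IV t (d y) + v_gammas IV t (v_C IV t (v_F IV t t0 y)) = 0.
    by have /bopP/(_ y) := dE.
  have lax : v_F IV t t0 (A y) = v_A1 IV t (v_F IV t t0 y).
    by have /bopP/(_ y) := v_lax IV t t0.
  by move/eqP: eqn; rewrite -lax addrAC subr_eq0 => /eqP <-.
- move=> t1; have [r r0 Gr] := absolutely_continuous_at t1 Gac ltr01.
  exists r => //; exists ((opnorm (G t1) + 1) * rnorm x) => n t /Gr/ltW tr.
  rewrite mulrCA; apply: (le_trans (opnormP _ _)).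
  apply: ler_pM; rewrite ?opnorm_ge0 ?rnorm_ge0 ?iter_opnorm//.
  have := rnormD (G t1) (G t - G t1); rewrite addrC subrK => /le_trans; apply.
  by rewrite lerD2l.
- by move=> n; rewrite /g /G /= v_F_id x0.
Qed.

End Observability.

Theorem theorem3p2 (R : realType) (IV : integral_vessel R) (t20 : R) :
  locally_observable (associated_system IV) t20 <->
  (forall t2 : R, observable (associated_system IV) t2).
Proof.
split=> [obs t2|obs]; apply/seteqP; split=> x /=.
- move=> xO.
  have /= F0 : v_F IV t20 t2 x = 0.
    suff : [set (0 : v_H IV t20)] (v_F IV t20 t2 x) by [].
    rewrite -obs => n _; exact: (xO n I t20 I).
  have [T [TF _]] := v_F_invertible IV t20 t2.
  by have /bopP/(_ x) /= := TF; rewrite F0 linear0.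
- by move=> -> n _ s _; rewrite /ker /= linear0 iter_fix ?linear0.
- move=> xO; suff : [set (0 : v_H IV t20)] x by [].
  rewrite -(obs t20) => n _ s _.
  apply: local_unobservable_transport => m; exact: (xO m I).
- by move=> -> n _; rewrite /ker /= iter_fix ?linear0.
Qed.
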